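(* Let $n\ge 1$ and let $L=(L_{ij})_{1\le i,j\le n}$ be an $n\times n$ Laplace-like matrix with real or complex entries, i.e. $L$ is symmetric and $\sum_{j=1}^n L_{ij}=0$ for every $i$. Let $C(L)$ denote the common value of all the cofactors of $L$. Then $$C(L)=(-1)^{n+1}\sum_{\tau}A_\tau(L),$$ where the sum is taken over all trees $\tau$ whose set of vertices is $\{1,\dots,n\}$, and $$A_\tau(L)=\prod_{i<j,\ \{i,j\}\in \mathrm{Edges}(\tau)}L_{ij}.$$
   Context: For an $n\times n$ matrix $L=(L_{ij})$, $M_{ij}(L)$ denotes the submatrix obtained by deleting the $i$-th row and the $j$-th column, and the $i,j$ cofactor of $L$ is $C_{ij}(L)=(-1)^{i+j}\det M_{ij}(L)$ (the determinant of the empty matrix is $1$, and an empty product is $1$). A matrix $L$ is called Laplace-like if it is symmetric and each of its rows sums to zero. If $L$ is Laplace-like then all its cofactors $C_{ij}(L)$ are equal, and $C(L)$ denotes their common value. Trees are undirected labelled trees: two trees on $\{1,\dots,n\}$ are the same if and only if they have the same edge set. $\mathrm{Edges}(\tau)$ is the set of edges of $\tau$, each edge being a two-element subset $\{i,j\}\subset\{1,\dots,n\}$. *)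

(* Defs.v *)
From mathcomp Require Import all_boot all_order all_algebra.

Set Implicit Arguments.
Unset Strict Implicit.
Unset Printing Implicit Defensive.

Import GRing.Theory.
Local Open Scope ring_scope.

(* The vertices 1, ..., n are represented by 'I_n, i.e. shifted to
   0, ..., n - 1; this preserves their order and the parity of i + j. *)

Definition laplace_like (K : comNzRingType) (n : nat) (L : 'M[K]_n) : Prop :=
  (forall i j : 'I_n, L i j = L j i) /\
  (forall i : 'I_n, \sum_(j < n) L i j = 0).

(* A labelled graph on 'I_n is identified with its set of edges. *)
Definition simple_graph (n : nat) (E : {set {set 'I_n}}) : Prop :=
  forall e : {set 'I_n}, e \in E -> #|e| = 2%N.

Definition adj (n : nat) (E : {set {set 'I_n}}) : rel 'I_n :=
  fun x y => [set x; y] \in E.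

Definition connected_graph (n : nat) (E : {set {set 'I_n}}) : Prop :=
  forall x y : 'I_n, connect (adj E) x y.

(* The bound on the size excludes the closed walk [:: x; y] along one edge. *)
Definition acyclic_graph (n : nat) (E : {set {set 'I_n}}) : Prop :=
  forall s : seq 'I_n, (2 < size s)%N -> uniq s -> ~ cycle (adj E) s.

Definition is_tree (n : nat) (E : {set {set 'I_n}}) : Prop :=
  [/\ simple_graph E, connected_graph E & acyclic_graph E].

Definition tree_weight (K : comNzRingType) (n : nat) (L : 'M[K]_n)
    (E : {set {set 'I_n}}) : K :=
  \prod_(i < n) \prod_(j < n | (i < j)%N && ([set i; j] \in E)) L i j.

(* Main.v *)
(* Zero row sums make every cofactor in row r equal to C_rr, the determinant of
   L with row r replaced by e_r. As row i of L is sum_j - L_ij (e_i - e_j),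
   multilinearity expands this determinant into a sum over functions f that
   fix r, with rows e_i - e_(f i) for i <> r. Such a determinant is 1 if every
   vertex reaches r under f, and 0 otherwise; the surviving functions are the
   parent functions of the trees rooted at r. *)
Require Import Defs.
From mathcomp Require Import all_boot all_order all_fingroup all_algebra.
From mathcomp Require Import boolp reals complex.

Set Implicit Arguments.
Unset Strict Implicit.
Unset Printing Implicit Defensive.

Import GRing.Theory.
Local Open Scope ring_scope.

(** * Trees as parent functions *)

Section RootedFunctions.
Variables (T : finType) (r : T).
Implicit Types (f g : {ffun T -> T}) (e : rel T).

(* A spanning tree is encoded by its parent function, the root being fixed. *)
Definition rooted f := (f r == r) && [forall x, fconnect f x r].

(** The root is left out since it has no parent: [f r = r] would give a singleton. *)
Definition parent_edges f : {set {set T}} := [set [set x; f x] | x in [set~ r]].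

Lemma rooted_root f : rooted f -> f r = r.
Proof. by case/andP=> /eqP. Qed.

Lemma rooted_connect f x : rooted f -> fconnect f x r.
Proof. by case/andP=> _ /forallP. Qed.

Lemma rooted_iter f x : rooted f -> exists k, iter k f x = r.
Proof.
by move=> fP; exists (findex f x r); apply/iter_findex/rooted_connect.
Qed.

Lemma rooted_depth f x :
  rooted f -> x != r -> findex f x r = (findex f (f x) r).+1.
Proof.
by move=> fP xr; apply: fconnect_findex; rewrite ?rooted_connect // eq_sym.
Qed.

Lemma rooted_neq f x : rooted f -> x != r -> f x != x.
Proof.
move=> fP xr; apply/eqP => fx.
by have := rooted_depth fP xr; rewrite fx => /eqP; rewrite ltn_eqF.
Qed.

(** Two steps towards the root lower the depth by two. Hence an edge determines which of its ends is
    the child. *)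
Lemma rooted_neq2 f x : rooted f -> x != r -> f (f x) != x.
Proof.
move=> fP xr; apply/eqP => ffx.
have fxr : f x != r.
  by apply: contraNneq xr => fx; rewrite -ffx fx (rooted_root fP).
have := rooted_depth fP xr; rewrite (rooted_depth fP fxr) ffx.
by move/eqP; rewrite ltn_eqF.
Qed.

Lemma eq_set2 (x y a b : T) :
  [set x; y] = [set a; b] -> (x = a /\ y = b) \/ (x = b /\ y = a).
Proof.
move=> E.
have: x \in [set a; b] by rewrite -E !inE eqxx.
have: y \in [set a; b] by rewrite -E !inE eqxx orbT.
have: a \in [set x; y] by rewrite E !inE eqxx.
have: b \in [set x; y] by rewrite E !inE eqxx orbT.
rewrite !inE => /orP[]/eqP h1 /orP[]/eqP h2 /orP[]/eqP h3 /orP[]/eqP h4;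
  subst; by [left | right].
Qed.

Lemma mem_parent_edges f x y :
  reflect ((x != r /\ y = f x) \/ (y != r /\ x = f y))
          ([set x; y] \in parent_edges f).
Proof.
apply: (iffP imsetP) => [[z]|].
  by rewrite !inE => zr /eq_set2[][-> ->]; [left | right].
case=> -[zr ->]; first by exists x; rewrite ?inE.
by exists y; rewrite ?inE // setUC.
Qed.

(** Induction on the distance to the root: once [f] and [g] agree at [f x], the edge from [x] to
    [f x] can only come from [g] at [x], as otherwise [f (f x) = x]. *)
Lemma parent_edges_inj : {in rooted &, injective parent_edges}.
Proof.
move=> f g fP gP Efg; apply/ffunP => x.
have [k] := rooted_iter x fP.
elim: k x => [|k IHk] x; first by move=> /= ->; rewrite !rooted_root.
rewrite iterSr => /IHk fgx.
have [->|xr] := eqVneq x r; first by rewrite !rooted_root.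
have : [set x; f x] \in parent_edges g.
  by rewrite -Efg; apply/mem_parent_edges; left.
case/mem_parent_edges=> [[]//|[_ xE]].
by have := rooted_neq2 fP xr; rewrite fgx -xE eqxx.
Qed.

(** Each vertex is sent to its successor on a shortest path to [r], so the distance [d] to [r]
    decreases strictly. *)
Lemma connect_rooted e :
  (forall x, connect e x r) ->
  exists2 f, rooted f & forall x, x != r -> e x (f x).
Proof.
move=> eC.
pose P x k := [exists p : k.-tuple T, path e x p && (last x p == r)].
have exP x : exists k, P x k.
  have /connectP[p ep rE] := eC x.
  by exists (size p); apply/existsP; exists (in_tuple p); rewrite /= ep -rE eqxx.
pose d x := ex_minn (exP x).
have step x : exists y, x != r -> e x y && (d y < d x)%N.
  have [->|xr] := eqVneq x r; first by exists r.
  rewrite {2}/d; case: ex_minnP => k /existsP[[p /= /eqP <-]] + _.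
  case: p => [|y p] /=; first by rewrite (negbTE xr).
  case/andP=> /andP[exy ep] /eqP rE; exists y => _; rewrite exy ltnS.
  rewrite /d; case: ex_minnP => m _; apply.
  by apply/existsP; exists (in_tuple p); rewrite /= ep rE eqxx.
have [h hP] := fin_all_exists step.
pose f := [ffun x => if x == r then r else h x].
have fE x : x != r -> f x = h x by move=> xr; rewrite ffunE (negbTE xr).
exists f => [|x xr]; last by rewrite fE //; case/andP: (hP x xr).
rewrite /rooted ffunE eqxx eqxx /=; apply/forallP => x.
have [m] := ubnP (d x); elim: m x => // m IHm x dx.
have [->|xr] := eqVneq x r; first exact: connect0.
rewrite fconnect_eqVf fE // IHm ?orbT //.
by case/andP: (hP x xr) => _ /leq_trans; apply.
Qed.

End RootedFunctions.

(** * Labelled trees and their weights through parent functions *)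

Section Trees.
Variables (n : nat) (r : 'I_n).
Implicit Types (f : {ffun 'I_n -> 'I_n}) (E : {set {set 'I_n}}).

Lemma adj_sym E : symmetric (adj E).
Proof. by move=> x y; rewrite /adj setUC. Qed.

Lemma parent_edges_connected f :
  rooted r f -> connected_graph (parent_edges r f).
Proof.
move=> fP.
have toroot x : connect (adj (parent_edges r f)) x r.
  have [k] := rooted_iter x fP.
  elim: k x => [|k IHk] x; first by move=> /= ->; apply: connect0.
  rewrite iterSr => /IHk; have [-> _|xr] := eqVneq x r; first exact: connect0.
  by apply: connect_trans; apply: connect1; apply/mem_parent_edges; left.
move=> x y; apply: connect_trans (toroot x) _.
by rewrite (sym_connect_sym (@adj_sym _)) toroot.
Qed.

(* The deepest vertex of a cycle would have two distinct parents. *)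
Lemma parent_edges_acyclic f : rooted r f -> acyclic_graph (parent_edges r f).
Proof.
move=> fP s s2 us cs.
have [x0 x0s] : exists x, x \in s
  by case: s s2 {us cs} => // x s; exists x; rewrite inE eqxx.
have [x xs xmax] := arg_maxnP (findex f ^~ r) x0s.
case: (rot_to xs) => i s' sE.
have up y : y \in s -> adj (parent_edges r f) x y -> y = f x.
  move=> ys /mem_parent_edges[[]//|[yr xE]].
  by have := xmax y ys; rewrite /= (rooted_depth fP yr) -xE ltnn.
move: us cs s2; rewrite -(rot_uniq i) -(rot_cycle i) -(size_rot i) sE.
have {}up y : y \in x :: s' -> adj (parent_edges r f) x y -> y = f x.
  by rewrite -sE mem_rot; apply: up.
(* The successor [y] and the predecessor [z] of [x] on the cycle are distinct because it has more
   than two vertices, yet both equal [f x]. *)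
case: s' sE up => // y; case/lastP=> // p z _ up.
rewrite /= -rcons_cons rcons_path /= last_rcons rcons_path.
rewrite mem_rcons inE negb_or => /and3P[_ /andP[yz _] _].
case/andP=> xy /andP[_ zx] _.
case/eqP: yz; rewrite [y]up ?in_cons ?eqxx ?orbT // [z]up //; last first.
  by rewrite adj_sym.
by rewrite !in_cons mem_rcons in_cons eqxx !orbT.
Qed.

Lemma parent_edges_tree f : rooted r f -> is_tree (parent_edges r f).
Proof.
move=> fP; split; [|exact: parent_edges_connected|exact: parent_edges_acyclic].
move=> _ /imsetP[x + ->]; rewrite !inE => xr.
by rewrite cards2 eq_sym (rooted_neq fP xr).
Qed.

(** A parent function chosen along the edges of [E] already uses all of them: a further edge would
    close a cycle with the path joining its ends. *)
Lemma tree_parent_edges E :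
  is_tree E -> exists2 f, rooted r f & parent_edges r f = E.
Proof.
case=> simE connE acycE; have [f fP fE] := connect_rooted (connE ^~ r).
exists f => //.
have sub : parent_edges r f \subset E.
  by apply/subsetP => _ /imsetP[x xr ->]; apply: fE; move: xr; rewrite !inE.
apply/eqP; rewrite eqEsubset sub; apply/subsetP => e eE.
have /eqP/cards2P[x [y [xy eD]]] := simE e eE; subst e.
apply/negPn/negP => xyN.
have /connectP[p0 /shortenP[p pp up _] yE] := parent_edges_connected fP x y.
apply: (acycE (x :: p)) => //=.
(* The cycle has at least three vertices: an empty path would give [x = y], and a single step would
   be the edge assumed missing. *)
- case: p pp yE {up} => [|a [|b p]] //= pp yE; first by rewrite yE eqxx in xy.
  by move: pp; rewrite andbT -yE /adj (negbTE xyN).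
- rewrite rcons_path -yE [adj _ y x]adj_sym /adj eE andbT.
  by apply: sub_path pp => a b /(subsetP sub).
Qed.

Lemma big_trees (K : nmodType) (F : {set {set 'I_n}} -> K) :
  \sum_(E : {set {set 'I_n}} | `[< is_tree E >]) F E =
  \sum_(f | rooted r f) F (parent_edges r f).
Proof.
rewrite -(big_imset _ (@parent_edges_inj _ r)) /=.
apply: eq_bigl => E; apply/asboolP/imsetP => [/tree_parent_edges[f fP <-]|].
  by exists f.
by case=> f fP ->; apply: parent_edges_tree.
Qed.

Lemma tree_weight_parent_edges (K : comNzRingType) (L : 'M[K]_n) f :
  (forall i j, L i j = L j i) -> rooted r f ->
  tree_weight L (parent_edges r f) = \prod_(i | i != r) L i (f i).
Proof.
move=> symL fP; rewrite /tree_weight pair_big_dep /=.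
(* [h] lists the edge above [i] in increasing order, as in [tree_weight]; symmetry of [L] absorbs
   the swap. *)
pose h (i : 'I_n) := if (i < f i)%N then (i, f i) else (f i, i).
have hinj : {in [set~ r] &, injective h}.
  move=> i j; rewrite !inE => ir _; have := rooted_neq2 fP ir; rewrite /h.
  case: ifP => _; case: ifP => _ ffi [] // e1 e2; case/eqP: ffi.
    by rewrite e2 -e1.
  by rewrite e1 -e2.
transitivity (\prod_(p in h @: [set~ r]) L p.1 p.2).
  apply: eq_bigl => -[i j] /=; apply/andP/imsetP.
    case=> ij /mem_parent_edges[][xr yE].
      by exists i; rewrite ?inE // /h -yE ij.
    by exists j; rewrite ?inE // /h -yE ltnNge (ltnW ij).
  case=> k; rewrite !inE => kr; rewrite /h.
  case: ifP => [kf|fk] [-> ->]; (split; last apply/mem_parent_edges).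
  - by [].
  - by left.
  - by rewrite ltn_neqAle leqNgt fk andbT; apply: (rooted_neq fP kr).
  - by right.
rewrite big_imset //=; apply: eq_big => [i|i _]; first by rewrite !inE.
by rewrite /h; case: ifP.
Qed.

End Trees.

(** * Determinants *)

Section Determinants.
Variable K : comNzRingType.

(** In each Leibniz term the product over rows of sums distributes into a sum over choice functions
    [f]. *)
Lemma det_sum_rows n (a : 'I_n -> 'I_n -> K) (b : 'I_n -> 'I_n -> 'I_n -> K) :
  \det (\matrix_(i, j) \sum_m a i m * b i m j) =
  \sum_(f : {ffun 'I_n -> 'I_n})
    (\prod_i a i (f i)) * \det (\matrix_(i, j) b i (f i) j).
Proof.
under [RHS]eq_bigr do rewrite big_distrr /=.
rewrite exchange_big; apply: eq_bigr => s _ /=.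
under eq_bigr do rewrite mxE.
rewrite bigA_distr_bigA big_distrr; apply: eq_bigr => f _ /=.
rewrite big_split mulrCA; congr (_ * (_ * _)).
by apply: eq_bigr => i _; rewrite mxE.
Qed.

(** Over a ring with zero divisors a nonzero kernel vector is not enough; an entry 1 lets [\det A]
    be read off from [\adj A *m A]. *)
Lemma det_ker n (A : 'M[K]_n) (v : 'cV_n) i :
  A *m v = 0 -> v i 0 = 1 -> \det A = 0.
Proof.
move=> Av vi; have: (\adj A *m A *m v) i 0 = 0.
  by rewrite -mulmxA Av mulmx0 mxE.
by rewrite mul_adj_mx mul_scalar_mx mxE vi mulr1.
Qed.

Lemma cofactor_det_unit_row n (A : 'M[K]_n) i j :
  cofactor A i j =
  \det (\matrix_(k, l) if k == i then (l == j)%:R else A k l).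
Proof.
rewrite (expand_det_row _ i) (bigD1 j) //= big1 => [|l lj]; last first.
  by rewrite mxE eqxx (negbTE lj) mul0r.
rewrite mxE !eqxx mul1r addr0; congr (_ * \det _).
by apply/matrixP => k l; rewrite !mxE eq_sym (negbTE (neq_lift _ _)).
Qed.

(** The two determinants differ by that of [C], whose row [i] is the difference of two unit rows.
    All rows of [C] sum to zero, so the all-ones vector lies in its kernel. *)
Lemma cofactor_row_sum0 n (A : 'M[K]_n) i j :
  (forall k, \sum_l A k l = 0) -> cofactor A i j = cofactor A i i.
Proof.
move=> A0; rewrite !cofactor_det_unit_row.
pose C := \matrix_(k, l) if k == i then (l == j)%:R - (l == i)%:R else A k l.
rewrite (@determinant_multilinear _ _ _
  (\matrix_(k, l) if k == i then (l == i)%:R else A k l) C i 1 1).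
- rewrite (@det_ker _ C (const_mx 1) i) ?mxE ?mulr0 ?addr0 ?mul1r //.
  apply/colP => k; rewrite !mxE.
  under eq_bigr do rewrite !mxE mulr1.
  case: eqP => // _; rewrite sumrB.
  have sum1 m : \sum_l (l == m)%:R = 1 :> K.
    by rewrite (bigD1 m) //= eqxx big1 ?addr0 // => l /negbTE ->.
  by rewrite !sum1 subrr.
- by apply/rowP => l; rewrite !mxE eqxx !mul1r addrC subrK.
- by apply/matrixP => k l; rewrite !mxE eq_sym (negbTE (neq_lift _ _)).
- by apply/matrixP => k l; rewrite !mxE eq_sym (negbTE (neq_lift _ _)).
Qed.

Definition parent_mx n (r : 'I_n) (f : {ffun 'I_n -> 'I_n}) : 'M[K]_n :=
  \matrix_(i, j) ((i == j)%:R - ((i != r) && (f i == j))%:R).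

(* A permutation contributing to the Leibniz formula moves each vertex to
   itself or to its parent, hence fixes all of them by induction on depth. *)
Lemma det_parent_mx_rooted n (r : 'I_n) f :
  rooted r f -> \det (parent_mx r f) = 1.
Proof.
move=> fP; rewrite /determinant (bigD1 (1%g : 'S_n)) //=.
rewrite [X in _ + X]big1 => [|s s1].
  rewrite odd_perm1 mul1r addr0 big1 // => i _.
  rewrite mxE perm1 eqxx; have [->|ir] := eqVneq i r; first by rewrite subr0.
  by rewrite (negbTE (rooted_neq fP ir)) subr0.
have [/existsP[i /andP[si /orP fi]]|] :=
    boolP [exists i, (s i != i) && ((i == r) || (s i != f i))].
  rewrite (bigD1 i) //= mxE eq_sym (negbTE si).
  suff -> : (i != r) && (f i == s i) = false by rewrite subr0 mul0r mulr0.
  by apply/negP => /andP[ir /eqP fE]; case: fi; rewrite ?(negbTE ir) // fE eqxx.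
rewrite negb_exists => /forallP sP; case/eqP: s1.
apply/permP => i; rewrite perm1.
have [k] := rooted_iter i fP.
elim: k i => [|k IHk] i.
  by move=> /= ->; have := sP r; rewrite eqxx andbT negbK => /eqP.
rewrite iterSr => /IHk sfi.
have := sP i; case: (eqVneq (s i) i) => //= si.
rewrite negb_or negbK => /andP[_ /eqP siE].
(* A moved vertex would share its image [f i] with its parent, which [s] fixes. *)
have /perm_inj iE : s (f i) = s i by rewrite sfi -siE.
by rewrite siE iE eqxx in si.
Qed.

(* The indicator of the set of vertices not leading to the root is in the
   kernel. *)
Lemma det_parent_mx_unrooted n (r : 'I_n) (f : {ffun 'I_n -> 'I_n}) :
  f r = r -> ~~ rooted r f -> \det (parent_mx r f) = 0.
Proof.
move=> fr; rewrite /rooted fr eqxx negb_forall => /existsP[x xN].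
apply: (@det_ker _ _ (\col_i (~~ fconnect f i r)%:R) x); last by rewrite mxE xN.
apply/colP => i; rewrite !mxE.
under eq_bigr do rewrite !mxE mulrBl.
rewrite sumrB (bigD1 i) //= eqxx mul1r big1 ?addr0; last first.
  by move=> j ji; rewrite eq_sym (negbTE ji) mul0r.
have [->|ir] := eqVneq i r.
  by rewrite connect0 big1 ?subrr // => j _; rewrite mul0r.
rewrite (bigD1 (f i)) //= eqxx mul1r big1 ?addr0; last first.
  by move=> j ji; rewrite eq_sym (negbTE ji) mul0r.
by rewrite [in X in X - _]fconnect_eqVf (negbTE ir) subrr.
Qed.

Lemma cofactor_rooted n (L : 'M[K]_n) (r : 'I_n) :
  (forall i, \sum_j L i j = 0) ->
  cofactor L r r =
  \sum_(f | rooted r f) \prod_(i | i != r) - L i (f i).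
Proof.
move=> L0; rewrite cofactor_det_unit_row.
(* The unit coefficient in row [r] kills every choice function that moves [r]. *)
pose a i m := if i == r then (m == r)%:R else - L i m.
pose b i m j : K := (i == j)%:R - ((i != r) && (m == j))%:R.
have -> : \matrix_(k, l) (if k == r then (l == r)%:R else L k l) =
          \matrix_(i, j) \sum_m a i m * b i m j.
  apply/matrixP => k l; rewrite !mxE /a /b.
  have [->|kr] /= := eqVneq k r.
    rewrite (bigD1 r) //= eqxx mul1r subr0 big1 ?addr0 1?eq_sym //.
    by move=> m /negbTE ->; rewrite mul0r.
  under eq_bigr do rewrite mulrBr.
  rewrite sumrB -mulr_suml sumrN L0 oppr0 mul0r sub0r.
  rewrite (bigD1 l) //= eqxx mulr1 big1 ?addr0 ?opprK // => m /negbTE ->.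
  by rewrite mulr0.
rewrite det_sum_rows [RHS]big_mkcond; apply: eq_bigr => f _ /=.
have prodE : f r = r -> \prod_i a i (f i) = \prod_(i | i != r) - L i (f i).
  move=> fr; rewrite (bigD1 r) //= {1}/a fr !eqxx mul1r.
  by apply: eq_bigr => i /negbTE ir; rewrite /a ir.
case: ifPn => fP.
  by rewrite prodE ?(rooted_root fP) // [\det _]det_parent_mx_rooted // mulr1.
have [fr|fr] := eqVneq (f r) r.
  by rewrite [\det _]det_parent_mx_unrooted // mulr0.
by rewrite (bigD1 r) //= {1}/a eqxx (negbTE fr) !mul0r.
Qed.

Lemma matrix_tree n (L : 'M[K]_n) (i j : 'I_n) :
  laplace_like L ->
  cofactor L i j =
    (-1) ^+ n.+1 *
    \sum_(E : {set {set 'I_n}} | `[< is_tree E >]) tree_weight L E.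
Proof.
case=> symL L0; rewrite cofactor_row_sum0 // cofactor_rooted //.
rewrite (big_trees i) big_distrr /=; apply: eq_bigr => f fP.
rewrite tree_weight_parent_edges // prodrN; congr (_ * _).
(* The [n.-1] non-root vertices give the sign; [n.-1] and [n.+1] have the same parity as [i] rules
   out [n = 0]. *)
have -> : #|[pred k | k != i]| = n.-1 by rewrite cardC1 card_ord.
by case: n i {L symL L0 f fP j} => [[]//|m _]; rewrite /= !exprS !mulN1r opprK.
Qed.

End Determinants.

Theorem theorem1 (R : realType) (n : nat) (n_ge1 : (1 <= n)%N) :
  (forall L : 'M[R]_n, laplace_like L ->
     forall i j : 'I_n,
       cofactor L i j =
         (-1) ^+ n.+1 *
         \sum_(E : {set {set 'I_n}} | `[< is_tree E >]) tree_weight L E) /\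
  (forall L : 'M[R[i]]_n, laplace_like L ->
     forall i j : 'I_n,
       cofactor L i j =
         (-1) ^+ n.+1 *
         \sum_(E : {set {set 'I_n}} | `[< is_tree E >]) tree_weight L E).
Proof. by split=> L LL i j; apply: matrix_tree. Qed.
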